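(* Let $n\ge 2$ be an integer and let $k$ be an integer with $2n-2\le k\le \frac{n^2-n+2}{2}$. Then there is a set $S_k$ of $n$ distinct real numbers with $a_{S_k}(n,1)=k$.
   Context: For a finite set $S\subset\mathbb{R}$ of $n$ points, $a_S(n,1)$ is the number of distinct orderings of $S$ induced by distance $|V-P|$ from a vantage point $V\in\mathbb{R}$, where $P_i$ precedes $P_j$ iff $|V-P_i|<|V-P_j|$; vantage points equidistant from two points of $S$ are ignored. Equivalently, $a_S(n,1)$ is one more than the number of distinct midpoints $\frac{P_i+P_j}{2}$, $i\ne j$. *)

(* Defs.v *)
From HB Require Import structures.
From mathcomp Require Import all_boot all_order all_algebra finmap.
From mathcomp Require Import boolp reals.

Set Implicit Arguments.
Unset Strict Implicit.
Unset Printing Implicit Defensive.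
Import Order.TTheory GRing.Theory Num.Theory.

Local Open Scope ring_scope.

Definition admissible_vantage (R : realType) (S : {fset R}) (V : R) : Prop :=
  forall P Q : S, P != Q -> `|V - val P| != `|V - val Q|.

(* The ordering induced by V is encoded as the set of pairs (P, Q) such that
   P precedes Q; it is a strict total order on S when V is admissible. *)
Definition vantage_ordering (R : realType) (S : {fset R}) (V : R) :
    {set S * S} :=
  [set PQ : S * S | `|V - val PQ.1| < `|V - val PQ.2|].

Definition num_orderings (R : realType) (S : {fset R}) : nat :=
  #|[set r : {set S * S} |
      `[< exists V : R, admissible_vantage S V /\ r = vantage_ordering S V >]]|.

(* Main.v *)
(** A vantage point V puts P before Q, for P < Q, iff 2V < P + Q.  Hence an ordering
    amounts to the set of pair sums exceeding 2V, an upper segment of the set T of pair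
    sums, and every upper segment occurs: there are #|T| + 1 orderings.

    It remains to realise every m with 2n - 3 <= m <= n(n-1)/2 as the number of pair sums
    of n naturals.  For m <= 3n - 6 take 0, ..., n - 2 together with m + 2 - n, whose
    pair sums are 1, ..., m.  For m >= 3n - 6, add to a solution for (n - 1, m - (n - 1))
    an element exceeding all of its pair sums: this creates n - 1 new sums. *)

Require Import Defs.
From HB Require Import structures.
From mathcomp Require Import all_boot all_order all_algebra finmap.
From mathcomp Require Import boolp reals.
From mathcomp Require Import zify lra.

Set Implicit Arguments.
Unset Strict Implicit.
Unset Printing Implicit Defensive.

Local Open Scope nat_scope.

Import Order.TTheory GRing.Theory Num.Theory.

(** Repetitions are kept, so distinct sums are counted after [undup]. The type is generic because
    the counting is done in [nat] and then transported to the reals. *)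
Fixpoint pair_sums (V : nmodType) (s : seq V) : seq V :=
  if s is x :: s' then [seq (x + y)%R | y <- s'] ++ pair_sums s' else [::].

Lemma pair_sumsP (V : nmodType) (s : seq V) (z : V) : uniq s ->
  z \in pair_sums s <->
  exists x y, [/\ x \in s, y \in s, x != y & z = (x + y)%R].
Proof.
elim: s => [|a s IHs] /=; first by split=> // -[x [y []]].
case/andP=> a_notin_s s_uniq; have {}IHs := IHs s_uniq.
rewrite mem_cat; split.
  case/orP=> [/mapP[y ys ->]|/IHs [x [y [xs ys xy ->]]]].
    exists a, y; rewrite !inE eqxx ys orbT; split=> //.
    by apply: contraNneq a_notin_s => ->.
  by exists x, y; rewrite !inE xs ys !orbT.
case=> x [y []]; rewrite !inE.
case/predU1P=> [->|xs] /predU1P[->|ys]; rewrite ?eqxx // => xy zE.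
- by rewrite zE map_f.
- by rewrite zE addrC map_f.
- by apply/orP; right; apply/IHs; exists x, y.
Qed.

Lemma pair_sums_map (U V : nmodType) (f : {additive U -> V}) (s : seq U) :
  pair_sums (map f s) = map f (pair_sums s).
Proof.
elim: s => //= x s ->; rewrite map_cat -!map_comp; congr (_ ++ _).
by apply: eq_map => y /=; rewrite raddfD.
Qed.

(** Each sum [x + y] is at least [x], hence larger than every old sum, and cancellation keeps these
    sums apart. *)
Lemma size_undup_pair_sums_cons (x : nat) (s : seq nat) : uniq s ->
  (forall z, z \in pair_sums s -> z < x) ->
  size (undup (pair_sums (x :: s))) = size s + size (undup (pair_sums s)).
Proof.
move=> s_uniq x_gt /=; rewrite undup_cat size_cat; congr (_ + _).
have all_new z : z \in [seq (x + y)%R | y <- s] -> z \notin pair_sums s.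
  by case/mapP=> y _ ->; apply: contraT => /negPn/x_gt; lia.
rewrite (eq_in_filter (a2 := predT)) => [|z]; last first.
  by rewrite mem_undup => /all_new ->.
by rewrite filter_predT undup_id ?size_map // map_inj_uniq // => y z; lia.
Qed.

(** Pairs from 0, ..., n give 1, ..., 2n - 1 and pairs with [x] give x, ..., x + n; as [x <= 2 * n]
    no gap is left between the two ranges. *)
Lemma size_undup_pair_sums_iota (n x : nat) : 0 < n -> n < x -> x <= 2 * n ->
  size (undup (pair_sums (x :: iota 0 n.+1))) = x + n.
Proof.
move=> n_gt0 n_lt_x x_le.
have s_uniq : uniq (x :: iota 0 n.+1).
  by rewrite cons_uniq iota_uniq mem_iota; lia.
rewrite -[RHS](size_iota 1); apply/perm_size/uniq_perm.
- exact: undup_uniq.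
- exact: iota_uniq.
move=> z; rewrite mem_undup mem_iota; apply/idP/idP.
  case/(pair_sumsP _ s_uniq)=> a [b []]; rewrite !in_cons !mem_iota.
  by move=> + + + ->; lia.
move=> z_bounds; apply/(pair_sumsP _ s_uniq).
have [x_le_z|z_lt_x] := leqP x z.
  exists x, (z - x); rewrite !in_cons !mem_iota.
  by split; lia.
have [z_le_n|n_lt_z] := leqP z n.
  by exists 0, z; rewrite !in_cons !mem_iota; split; lia.
by exists n, (z - n); rewrite !in_cons !mem_iota; split; lia.
Qed.

Lemma exists_num_pair_sums (n m : nat) :
  2 * n.+2 - 3 <= m -> m <= 'C(n.+2, 2) ->
  exists s : seq nat,
    [/\ uniq s, size s = n.+2 & size (undup (pair_sums s)) = m].
Proof.
elim: n m => [|n IHn] m m_ge m_le.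
  have ->: m = 1 by move: m_le; rewrite binn; lia.
  by exists [:: 0; 1].
have [m_small|m_large] := leqP m (3 * n.+3 - 6).
  (* The largest sum is to be m, so the extra element is m minus n + 1, the maximum of the
     [iota]. *)
  exists (m - n.+1 :: iota 0 n.+2); split.
  - by rewrite cons_uniq iota_uniq mem_iota; lia.
  - by rewrite /= size_iota.
  - by rewrite size_undup_pair_sums_iota; lia.
have [||s [s_uniq s_size s_sums]] := IHn (m - n.+2).
- lia.
- by move: m_le; rewrite binS bin1; lia.
(* Bounding the elements of [s] as well ensures that [x] is not in [s]. *)
pose x := (\max_(i <- s ++ pair_sums s) i).+1.
have x_gt z : z \in s ++ pair_sums s -> z < x.
  by move=> zs; rewrite ltnS (leq_bigmax_seq (F := id)).
exists (x :: s); split.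
- rewrite cons_uniq s_uniq andbT; apply/negP=> xs.
  by have := x_gt x; rewrite mem_cat xs ltnn => /(_ isT).
- by rewrite /= s_size.
- rewrite size_undup_pair_sums_cons // ?s_size ?s_sums; first lia.
  by move=> z zs; apply: x_gt; rewrite mem_cat zs orbT.
Qed.

Local Open Scope fset_scope.
Local Open Scope ring_scope.

Lemma closer_to_left (R : realDomainType) (V P Q : R) : P < Q ->
  (`|V - P| < `|V - Q|) = (V *+ 2 < P + Q).
Proof.
move=> PQ; rewrite mulr2n.
by case: (ger0P (V - P)) => ?; case: (ger0P (V - Q)) => ?; apply/idP/idP; lra.
Qed.

Lemma equidistant_sum (R : realDomainType) (V P Q : R) : P != Q ->
  (`|V - P| == `|V - Q|) = (V *+ 2 == P + Q).
Proof.
move=> PQ; rewrite eqr_norm2; apply/idP/idP.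
  case/orP=> /eqP VPQ; apply/eqP; last by rewrite mulr2n; lra.
  by case/eqP: PQ; lra.
by move/eqP=> VPQ; apply/orP; right; apply/eqP; move: VPQ; rewrite mulr2n; lra.
Qed.

(** [None] acts as plus infinity: [w] lies below the bound [o] but above all members of [T] that are
    below it. Each new such member [a] is cleared by raising [w] to at least the midpoint of [a] and
    [s], or to [a + 1] if there is no bound. *)
Lemma exists_separating (R : realFieldType) (T : seq R) (o : option R) :
  exists w, (if o is Some s then w < s else true) /\
    forall z, z \in T -> (if o is Some s then z < s else true) -> z < w.
Proof.
elim: T => [|a T [w [w_lt w_gt]]].
  by case: o => [s|]; [exists (s - 1) | exists 0]; split=> //; lra.
case: o w_lt w_gt => [s|] w_lt w_gt.
  have [s_le|a_lt] := lerP s a.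
    exists w; split=> // z; rewrite inE => /predU1P[->|/w_gt //].
    by rewrite ltNge s_le.
  exists (Num.max w ((a + s) / 2)); split; first by rewrite gt_max w_lt; lra.
  move=> z; rewrite inE lt_max => /predU1P[-> _|zT zs].
    by apply/orP; right; lra.
  by rewrite w_gt.
exists (Num.max w (a + 1)); split=> // z; rewrite inE lt_max.
by case/predU1P=> [-> _|zT _]; [rewrite ltrDl ltr01 orbT | rewrite w_gt].
Qed.

(** The least member of [T] above [w], if any, determines the upper segment cut off by [w]. *)
Lemma exists_next (R : realDomainType) (T : seq R) (w : R) :
  (forall z, z \in T -> z <= w) \/
  exists s, [/\ s \in T, w < s & forall z, z \in T -> w < z -> s <= z].
Proof.
elim: T => [|a T IHT]; first by left.
have [a_le|w_lt] := lerP a w.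
  case: IHT => [T_le|[s [sT ws s_min]]].
    by left=> z; rewrite inE => /predU1P[->|/T_le].
  right; exists s; split; rewrite ?inE ?sT ?orbT // => z.
  by rewrite inE => /predU1P[->|/s_min //]; rewrite ltNge a_le.
right; case: IHT => [T_le|[s [sT ws s_min]]].
  exists a; split; rewrite ?mem_head // => z.
  by rewrite inE => /predU1P[->|/T_le] //; rewrite leNgt => /negPf ->.
have [sa|a_s] := lerP s a.
  exists s; split; rewrite ?inE ?sT ?orbT // => z.
  by rewrite inE => /predU1P[->|/s_min].
exists a; split; rewrite ?mem_head // => z.
rewrite inE => /predU1P[->|zT wz] //.
exact: le_trans (ltW a_s) (s_min _ zT wz).
Qed.

Lemma num_orderingsE (R : realType) (S : {fset R}) (T : seq R) : uniq T ->
  (forall z, z \in T <->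
    exists x y, [/\ x \in S, y \in S, x != y & z = x + y]) ->
  num_orderings S = (size T).+1.
Proof.
move=> T_uniq TP.
have TPlt z : z \in T -> exists P Q : S, val P < val Q /\ z = val P + val Q.
  case/TP=> x [y [xS yS xy ->]].
  move: xy; rewrite neq_lt => /orP[xy|yx].
    by exists [` xS], [` yS].
  by exists [` yS], [` xS]; rewrite addrC.
have sumT (P Q : S) : P != Q -> val P + val Q \in T.
  by move=> PQ; apply/TP; exists (val P), (val Q); split=> //; apply: valP.
have admP V : admissible_vantage S V <-> V *+ 2 \notin T.
  split=> [V_adm|VT P Q PQ]; last first.
    rewrite equidistant_sum //; apply: contraNneq VT => ->.
    exact: sumT.
  apply/negP=> /TPlt[P [Q [PQ VPQ]]].
  have PQ' : P != Q by rewrite -(inj_eq val_inj) lt_eqF.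
  by have := V_adm P Q PQ'; rewrite equidistant_sum // VPQ eqxx.
have same_cut V V' : vantage_ordering S V = vantage_ordering S V' ->
    forall z, z \in T -> (V *+ 2 < z) = (V' *+ 2 < z).
  move=> VV' z /TPlt[P [Q [PQ ->]]]; rewrite -!closer_to_left //.
  by have /setP/(_ (P, Q)) := VV'; rewrite !inE.
have cut_same V V' : V *+ 2 \notin T -> V' *+ 2 \notin T ->
    (forall z, z \in T -> (V *+ 2 < z) = (V' *+ 2 < z)) ->
    vantage_ordering S V = vantage_ordering S V'.
  move=> VT V'T cut; apply/setP=> -[P Q]; rewrite !inE /=.
  have [<-|PQ] := eqVneq P Q; first by rewrite !ltxx.
  have QP : Q != P by rewrite eq_sym.
  have /orP[lt_PQ|lt_QP] : (val P < val Q) || (val Q < val P).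
  - by rewrite -neq_lt (inj_eq val_inj).
  - by rewrite !closer_to_left // cut // sumT.
  (* Admissibility excludes ties, so the case Q < P is the negation of the comparison with P and Q
     exchanged. *)
  have leE W : W *+ 2 \notin T ->
      (`|W - val P| < `|W - val Q|) = ~~ (W *+ 2 < val Q + val P).
    move=> WT; rewrite -closer_to_left // -leNgt lt_neqAle.
    by have /admP/(_ _ _ PQ) -> := WT.
  by rewrite !leE // cut // sumT.
(* [w (Some s)] is twice a vantage point just below the sum s, [w None] one above all. *)
have [w w_sep] := choice (exists_separating T).
pose V_ (o : option (seq_sub T)) := w (omap val o) / 2.
have V2 o : V_ o *+ 2 = w (omap val o) by rewrite /V_ mulr2n; lra.
have w_cut o z : z \in T ->
    (w o < z) = if o is Some s then s <= z else false.
  case: (w_sep o) => w_lt w_gt zT; case: o w_lt w_gt => [s|] w_lt w_gt.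
    have [s_le|z_lt] := lerP s z; first exact: lt_le_trans s_le.
    by apply/negbTE; rewrite -leNgt ltW // w_gt.
  by apply/negbTE; rewrite -leNgt ltW // w_gt.
have w_notin o : w o \notin T.
  apply/negP=> wT; have := w_cut o _ wT; case: (w_sep o) => w_lt w_gt.
  case: o w_lt w_gt wT => [s|] w_lt w_gt wT.
    by have := w_gt _ wT w_lt; rewrite ltxx.
  by have := w_gt _ wT isT; rewrite ltxx.
(* The least sum of the upper segment recovers [o]: testing the cuts at [s] and [s'] gives both
   inequalities, and an empty segment means [None]. *)
have V_inj : injective (fun o => vantage_ordering S (V_ o)).
  move=> o o' /same_cut; rewrite !V2 => cut.
  case: o o' cut => [s|] [s'|] cut //.
  - congr Some; apply/val_inj/le_anti/andP; split.
      by have := cut _ (valP s'); rewrite !w_cut ?ssvalP //= lexx.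
    by have := cut _ (valP s); rewrite !w_cut ?ssvalP //= lexx.
  - by have := cut _ (valP s); rewrite !w_cut ?ssvalP //= lexx.
  - by have := cut _ (valP s'); rewrite !w_cut ?ssvalP //= lexx.
rewrite /num_orderings.
rewrite (_ : [set r | _] = [set vantage_ordering S (V_ o) | o in predT]).
  by rewrite card_imset // card_option card_seq_sub.
apply/setP=> r; rewrite inE; apply/asboolP/imsetP => [[V [/admP VT ->]]|[o _ ->]].
  (* Surjectivity: V induces the same ordering as the representative indexed by the next sum above
     2V. *)
  have [T_le|[s [sT Vs s_min]]] := exists_next T (V *+ 2).
    exists None => //; apply: cut_same; rewrite ?V2 // => z zT.
    by rewrite w_cut //= ltNge T_le.
  exists (Some (SeqSub sT)) => //; apply: cut_same; rewrite ?V2 // => z zT.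
  rewrite w_cut //=; apply/idP/idP => [|s_le]; first exact: s_min.
  exact: lt_le_trans s_le.
by exists (V_ o); split=> //; apply/admP; rewrite V2.
Qed.

Local Close Scope ring_scope.

Theorem theorem3p1 (R : realType) (n k : nat) (hn : 2 <= n)
  (hk_lower : 2 * n - 2 <= k) (hk_upper : k <= (n ^ 2 - n + 2) %/ 2) :
  exists S : {fset R}, #|` S| = n /\ num_orderings S = k.
Proof.
case: n hn hk_lower hk_upper => [|[|n]] // _ hk_lower hk_upper.
have [||s [s_uniq s_size s_sums]] := @exists_num_pair_sums n k.-1.
- lia.
- rewrite bin2 -divn2; move: hk_upper; rewrite expnS expn1.
  have -> : n.+2 * n.+2 - n.+2 = n.+2 * n.+2.-1 by nia.
  by lia.
(* The embedding of the naturals is additive and injective, so it preserves the number of distinct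
   pair sums. *)
pose f : {additive nat -> R} := GRing.natmul (1 : R)%R.
have f_inj : injective f by move=> x y /eqP; rewrite eqr_nat => /eqP.
have fs_uniq : uniq (map f s) by rewrite map_inj_uniq.
exists [fset x in map f s]; split.
  by rewrite card_fseq undup_id // size_map.
rewrite (@num_orderingsE _ _ (undup (pair_sums (map f s)))) ?undup_uniq //.
  by rewrite pair_sums_map undup_map_inj // size_map s_sums; lia.
move=> z; rewrite mem_undup (pair_sumsP _ fs_uniq).
by split=> -[x [y [xs ys xy ->]]]; exists x, y; rewrite ?inE in xs ys *.
Qed.
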